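(* Let $n\geq 6$ and let $G$ be a graph of order $n$. If $G$ contains no $C_5$, then \[ q(G)<q(S_{n,2}), \] unless $G=S_{n,2}$.
   Context: Graphs are finite, simple and undirected; the order of a graph is its number of vertices. For a graph $G$, the signless Laplacian is $Q(G)=D(G)+A(G)$, where $D(G)$ is the diagonal matrix of vertex degrees and $A(G)$ is the adjacency matrix; $q(G)$ (the $Q$-index) denotes the largest eigenvalue of $Q(G)$. $C_5$ is the cycle of length $5$; ''$G$ contains no $C_5$'' means that $G$ has no subgraph (not necessarily induced) isomorphic to $C_5$. $S_{n,k}=K_k\vee\overline{K}_{n-k}$ is the graph of order $n$ obtained by joining each vertex of the complete graph $K_k$ to each vertex of an independent set of order $n-k$. Equality of graphs means isomorphism. *)

(* Defs.v *)
From HB Require Import structures.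
From mathcomp Require Import all_boot all_order all_algebra.
From mathcomp Require Import lra complex polyrcf classical_sets reals.

Set Implicit Arguments.
Unset Strict Implicit.
Unset Printing Implicit Defensive.

Import Order.TTheory GRing.Theory Num.Theory.
Local Open Scope ring_scope.

Record sgraph := SGraph {
  vertex :> finType;
  edge : rel vertex;
  edge_sym : symmetric edge;
  edge_irr : irreflexive edge }.

Definition isomorphic (G H : sgraph) : Prop :=
  exists2 f : G -> H, bijective f & forall x y, edge (f x) (f y) = edge x y.

(* H is isomorphic to a subgraph, not necessarily induced, of G. *)
Definition contains (G H : sgraph) : Prop :=
  exists2 f : H -> G, injective f & forall x y, edge x y -> edge (f x) (f y).

Section Constructions.

Definition complete_rel n : rel 'I_n := fun i j => i != j.

Lemma complete_sym n : symmetric (@complete_rel n).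
Proof. by move=> i j; rewrite /complete_rel eq_sym. Qed.

Lemma complete_irr n : irreflexive (@complete_rel n).
Proof. by move=> i; rewrite /complete_rel eqxx. Qed.

Definition complete n : sgraph := SGraph (@complete_sym n) (@complete_irr n).

Definition compl_rel (G : sgraph) : rel G :=
  fun x y => (x != y) && ~~ edge x y.

Lemma compl_sym G : symmetric (@compl_rel G).
Proof. by move=> x y; rewrite /compl_rel eq_sym edge_sym. Qed.

Lemma compl_irr G : irreflexive (@compl_rel G).
Proof. by move=> x; rewrite /compl_rel eqxx. Qed.

Definition complement (G : sgraph) : sgraph :=
  SGraph (@compl_sym G) (@compl_irr G).

Definition join_rel (G H : sgraph) : rel (G + H)%type := fun x y =>
  match x, y with
  | inl a, inl b => edge a b
  | inr a, inr b => edge a b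
  | _, _ => true
  end.

Lemma join_sym G H : symmetric (@join_rel G H).
Proof. by case=> x [] y //=; rewrite edge_sym. Qed.

Lemma join_irr G H : irreflexive (@join_rel G H).
Proof. by case=> x /=; rewrite edge_irr. Qed.

Definition join (G H : sgraph) : sgraph :=
  SGraph (@join_sym G H) (@join_irr G H).

(* The conjunct [i != j] only matters for n = 1, where it removes the loop. *)
Definition cycle_rel n : rel 'I_n := fun i j =>
  (i != j) && ((j == i.+1 %% n :> nat)%N || (i == j.+1 %% n :> nat)%N).

Lemma cycle_sym n : symmetric (@cycle_rel n).
Proof. by move=> i j; rewrite /cycle_rel eq_sym orbC. Qed.

Lemma cycle_irr n : irreflexive (@cycle_rel n).
Proof. by move=> i; rewrite /cycle_rel eqxx. Qed.

Definition cycle_graph n : sgraph := SGraph (@cycle_sym n) (@cycle_irr n).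

(* Meaningful for k <= n; its order is then n. *)
Definition S_graph n k : sgraph :=
  join (complete k) (complement (complete (n - k))).

End Constructions.

Section SignlessLaplacian.
Variables (R : realType) (G : sgraph).

Definition degree (x : G) : nat := #|[set y | edge x y]|.

(* Rows and columns are numbered by the standard enumeration of the vertices. *)
Definition adjacency_mx : 'M[R]_#|G| :=
  \matrix_(i, j) (edge (enum_val i) (enum_val j))%:R.

Definition degree_mx : 'M[R]_#|G| :=
  diag_mx (\row_i (degree (enum_val i))%:R).

Definition signless_laplacian : 'M[R]_#|G| := degree_mx + adjacency_mx.

(* This supremum is a maximum as soon as G has a vertex: see Qindex_max. *)
Definition Qindex : R := sup [set a | eigenvalue signless_laplacian a]%classic.

Lemma signless_laplacian_sym : signless_laplacian^T = signless_laplacian.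
Proof.
rewrite /signless_laplacian linearD /= tr_diag_mx; congr (_ + _).
by apply/matrixP => i j; rewrite !mxE edge_sym.
Qed.

End SignlessLaplacian.

Lemma sym_eigenvalue_exists (R : rcfType) n (A : 'M[R]_n) :
  (0 < n)%N -> A^T = A -> exists a, eigenvalue A a.
Proof.
move=> n0 symA.
pose f : {rmorphism R -> R[i]} := real_complex R.
have : size (char_poly (map_mx f A)) != 1 by rewrite size_char_poly eqSS -lt0n.
case/closed_rootP => z; rewrite -eigenvalue_root_char => /eigenvalueP[v vA v0].
pose u := map_mx (@complex.Re R) v; pose w := map_mx (@complex.Im R) v.
have ReS (I : finType) (F : I -> R[i]) : complex.Re (\sum_i F i) = \sum_i complex.Re (F i).
  by apply: (big_morph (@complex.Re R)) => // -[? ?] [? ?].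
have ImS (I : finType) (F : I -> R[i]) : complex.Im (\sum_i F i) = \sum_i complex.Im (F i).
  by apply: (big_morph (@complex.Im R)) => // -[? ?] [? ?].
have uA : u *m A = complex.Re z *: u - complex.Im z *: w.
  apply/rowP => j; move/rowP: vA => /(_ j) /(congr1 (@complex.Re R)).
  rewrite !mxE ReS => vAj; transitivity (complex.Re (z * v 0 j)).
    rewrite -vAj; apply: eq_bigr => k _; rewrite !mxE.
    by case: (v 0 k) => a b /=; rewrite mulr0 subr0.
  by case: (v 0 j) (z) => a b [c d].
have wA : w *m A = complex.Im z *: u + complex.Re z *: w.
  apply/rowP => j; move/rowP: vA => /(_ j) /(congr1 (@complex.Im R)).
  rewrite !mxE ImS => vAj; transitivity (complex.Im (z * v 0 j)).
    rewrite -vAj; apply: eq_bigr => k _; rewrite !mxE.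
    by case: (v 0 k) => a b /=; rewrite mulr0 add0r.
  by case: (v 0 j) (z) => a b [c d] /=; rewrite addrC.
have trs (x y : 'rV[R]_n) : (x *m y^T) 0 0 = (y *m x^T) 0 0.
  by rewrite !mxE; apply: eq_bigr => i _; rewrite !mxE mulrC.
have sq_ge0 (x : 'rV[R]_n) : 0 <= (x *m x^T) 0 0.
  by rewrite mxE; apply: sumr_ge0 => i _; rewrite mxE -expr2 sqr_ge0.
have sq_eq0 (x : 'rV[R]_n) : (x *m x^T) 0 0 = 0 -> x = 0.
  rewrite mxE => /eqP; rewrite psumr_eq0; last first.
    by move=> i _; rewrite mxE -expr2 sqr_ge0.
  move/allP => x0; apply/rowP => i; have := x0 i (mem_index_enum _).
  by rewrite !mxE mulf_eq0 orbb => /eqP.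
have zuw : complex.Im z * ((u *m u^T) 0 0 + (w *m w^T) 0 0) = 0.
  have : ((u *m A) *m w^T) 0 0 = ((w *m A) *m u^T) 0 0.
    by rewrite trs trmx_mul symA mulmxA.
  rewrite uA wA mulmxBl mulmxDl -!scalemxAl.
  have E (x y : 'rV[R]_n) c d (t : 'cV[R]_n) :
      (c *: (x *m t) + d *: (y *m t)) 0 0 = c * (x *m t) 0 0 + d * (y *m t) 0 0.
    by rewrite !mxE.
  by rewrite -scaleNr !E (trs u w) => e; lra.
have Imz0 : complex.Im z = 0.
  apply/eqP; move/eqP: zuw; rewrite mulf_eq0 => /orP[//|].
  rewrite paddr_eq0 // => /andP[/eqP/sq_eq0 u0 /eqP/sq_eq0 w0].
  case/negP: v0; apply/eqP/rowP => i; rewrite !mxE.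
  move/rowP: u0 => /(_ i); move/rowP: w0 => /(_ i); rewrite !mxE.
  by case: (v 0 i) => a b /= -> ->.
exists (complex.Re z); rewrite -(eigenvalue_map f).
apply/eigenvalueP; exists v => //; rewrite vA; congr (_ *: _).
by rewrite -[f _]/((complex.Re z)%:C)%C -{1}[z]/z; case: z Imz0 {vA uA wA zuw} => a b /= ->.
Qed.

Lemma Qindex_max (R : realType) (G : sgraph) : (0 < #|G|)%N ->
  eigenvalue (signless_laplacian R G) (Qindex R G) /\
  forall a, eigenvalue (signless_laplacian R G) a -> a <= Qindex R G.
Proof.
move=> n0; rewrite /Qindex.
have [a0 a0P] := sym_eigenvalue_exists n0 (signless_laplacian_sym R G).
set A := signless_laplacian R G in a0P *.
have pA0 : char_poly A != 0 by rewrite monic_neq0 ?char_poly_monic.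
pose s := rootsR (char_poly A).
have sP a : (a \in s) = eigenvalue A a.
  by rewrite /s -roots_on_rootsR // eigenvalue_root_char.
have [m ms ltm] : exists2 m, m \in s & forall a, a \in s -> a <= m.
  have: a0 \in s by rewrite sP.
  elim: s a0 {sP a0P} => // b t IH c _.
  case: t IH => [|c' t] IH; first by exists b; rewrite ?inE // => a /[!inE] /eqP->.
  have [m mt ltm] := IH c' (mem_head _ _).
  case: (leP b m) => bm.
    by exists m; [rewrite inE mt orbT | move=> a /predU1P[->|/ltm]].
  exists b; first exact: mem_head.
  by move=> a /predU1P[->|/ltm/le_trans]//; apply; apply: ltW.
have mub a : eigenvalue A a -> a <= m by rewrite -sP => /ltm.
have ubm : ubound [set a | eigenvalue A a]%classic m by move=> a /mub.
suff -> : sup [set a | eigenvalue A a]%classic = m by rewrite -sP.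
apply/eqP; rewrite eq_le; apply/andP; split.
  by apply: ge_sup => //; exists a0.
by apply: ub_le_sup; [exists m | rewrite /= -sP].
Qed.

(* Main.v *)
Require Import Defs.
From mathcomp Require Import all_boot all_order all_algebra.
From mathcomp Require Import reals.
From mathcomp Require Import zify lra.

(** Write [N u] for the neighbourhood of [u], [h v] for the number of common
    neighbours of [u] and [v], and [q0] for the larger root of
    [x ^ 2 - (n + 2) x + 4].  The graph [S_graph n 2] has the eigenvalue [q0]
    (constant on each side of the join), and [q0 = n + 2 - 4 / q0] gives
    [q0 > n + 2 - 4 / (n + 1)].  It remains to push every eigenvalue of [G]
    below [q0], and for this it suffices to exhibit one positive vector [y] with
    [Q y < q0 y] in every coordinate ([eigenvalue_lt]).  The vectors used have
    natural entries, so that the test is an inequality between natural numbers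
    ([eigenvalue_lt_nat]).

    Without a 5-cycle the graph induced on [N u] has no path on four vertices,
    so its components are stars (isolated vertices and single edges included)
    and triangles; [codegree_edge] is the local form of this fact, and
    [sum_codegree_nbhd] the resulting bound on the number of edges in [N u].
    Moreover a vertex outside [N u] with two or more neighbours in [N u] sees
    only isolated vertices of [N u], or exactly the two ends of an isolated edge
    ([codegree_far]).

    If no vertex is adjacent to all others, take for [y] the degrees.  The
    coordinate of [Q y] at [u] is [d(u) ^ 2] plus the sum of the degrees of
    the neighbours of [u]; that sum counts the walks of length two from [u], and
    sorting them by their last vertex turns the two local facts into the required
    bound ([sum_degree_bound]).

    If [u] is adjacent to all others, degrees fail as weights: they already fail
    for [S_graph n 2].  If moreover some [w] has [h w = n - 2], then [w] is
    adjacent to all others too, and any further edge would close a 5-cycle, so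
    [G] is [S_graph n 2] ([isomorphic_S_graph2]).  Otherwise weights affine in
    [h] on [N u], with a suitable weight at [u], pass the test
    ([dominated_bound]). *)

Set Implicit Arguments.
Unset Strict Implicit.
Unset Printing Implicit Defensive.

Import Order.TTheory GRing.Theory Num.Theory.
Local Open Scope ring_scope.

(** * Neighbourhoods and codegrees *)

Definition nbhd (G : sgraph) (x : G) : {set G} := [set y | edge x y].

(** For adjacent [x] and [y] this is also the degree of [y] in the graph induced
    on the neighbourhood of [x], which is how it is mostly used. *)
Definition codegree (G : sgraph) (x y : G) : nat := #|nbhd x :&: nbhd y|.

Lemma in_nbhd (G : sgraph) (x y : G) : (y \in nbhd x) = edge x y.
Proof. by rewrite inE. Qed.

Lemma in_conbhd (G : sgraph) (x y z : G) :
  (z \in nbhd x :&: nbhd y) = edge x z && edge y z.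
Proof. by rewrite !inE. Qed.

Lemma edge_neq (G : sgraph) (x y : G) : edge x y -> x != y.
Proof. by apply: contraTneq => ->; rewrite edge_irr. Qed.

(** * Eigenvalues of the signless Laplacian *)

(** This removes the numbering of the vertices: row vectors become functions on
    the vertices. *)
Lemma eigenvalue_signlessP (R : realType) (G : sgraph) (a : R) :
  reflect
    (exists2 f : G -> R, (exists x, f x != 0) &
       forall x, (degree x)%:R * f x + \sum_(y | edge x y) f y = a * f x)
    (eigenvalue (signless_laplacian R G) a).
Proof.
have E (v : 'rV[R]_#|G|) j : (v *m signless_laplacian R G) 0 j =
    (degree (enum_val j))%:R * v 0 j
    + \sum_(y | edge (enum_val j) y) v 0 (enum_rank y).
  rewrite /signless_laplacian mulmxDr mxE; congr (_ + _).
    by rewrite /degree_mx mul_mx_diag !mxE mulrC.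
  rewrite mxE (reindex (@enum_rank G)) /=; last first.
    by exists enum_val => y _; rewrite ?enum_rankK ?enum_valK.
  rewrite [RHS]big_mkcond /=; apply: eq_bigr => y _.
  rewrite mxE enum_rankK edge_sym.
  by case: edge; rewrite ?mulr1 ?mulr0.
apply: (iffP eigenvalueP) => [[v vQ v0]|[f [x fx0] fQ]].
  exists (fun x => v 0 (enum_rank x)).
    have /rV0Pn[j vj] := v0; exists (enum_val j).
    by rewrite enum_valK.
  move=> x; have := congr1 (fun M : 'rV_ _ => M 0 (enum_rank x)) vQ.
  by rewrite E enum_rankK mxE.
exists (\row_j f (enum_val j)).
  apply/rowP => j; rewrite E !mxE -fQ; congr (_ + _).
  by apply: eq_bigr => y _; rewrite mxE enum_rankK.
apply/rV0Pn; exists (enum_rank x); by rewrite mxE enum_rankK.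
Qed.

(** Let [f] be an eigenvector for [a] and [x] a vertex where [`|f x| / y x] is
    maximal, with value [t].  As [`|f|] is at most [t y] everywhere and [Q] has
    nonnegative entries, [a `|f x|] is at most [t] times the coordinate of [Q y]
    at [x], which is less than [t l y x = l `|f x|]. *)
Lemma eigenvalue_lt (R : realType) (G : sgraph) (y : G -> R) (l : R) :
  (forall x, 0 < y x) ->
  (forall x, (degree x)%:R * y x + \sum_(z | edge x z) y z < l * y x) ->
  forall a, eigenvalue (signless_laplacian R G) a -> a < l.
Proof.
move=> y0 yl a /eigenvalue_signlessP[f [x0 fx0] fQ].
have [x _ xmax] := arg_maxP (fun x => `|f x| / y x) (erefl : predT x0).
pose t := `|f x| / y x.
have ft z : `|f z| <= t * y z by rewrite -ler_pdivrMr //; apply: xmax.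
have t0 : 0 < t.
  apply: lt_le_trans (xmax x0 isT).
  by rewrite divr_gt0 // normr_gt0.
have fx : `|f x| = t * y x by rewrite divfK // gt_eqF.
have fx_gt0 : 0 < `|f x| by rewrite fx mulr_gt0.
rewrite -(ltr_pM2r fx_gt0).
apply: (@le_lt_trans _ _ `|a * f x|).
  by rewrite normrM ler_pM2r // ler_norm.
rewrite -fQ; apply: le_lt_trans (ler_normD _ _) _.
rewrite normrM ger0_norm // fx [ltRHS]mulrCA.
apply: le_lt_trans (_ : _ <= t * ((degree x)%:R * y x + \sum_(z | edge x z) y z)) _.
  rewrite mulrDr [in leRHS]mulrCA lerD2l mulr_sumr.
  apply: le_trans (ler_norm_sum _ _ _) _.
  by apply: ler_sum => z _; apply: ft.
by rewrite ltr_pM2l.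
Qed.

(** The constants are those of the lower bound [n + 2 - 4 / (n + 1)] for the
    target, multiplied by [n + 1] to clear the denominator.  The strict
    inequality is left to the hypothesis on [l]. *)
Lemma eigenvalue_lt_nat (R : realType) (G : sgraph) (y : G -> nat) (l : R) :
  #|G|.+1%:R * #|G|.+2%:R - 4 < #|G|.+1%:R * l ->
  (forall x, 0 < y x)%N ->
  (forall x, #|G|.+1 * (degree x * y x + \sum_(z | edge x z) y z) + 4 * y x
     <= #|G|.+1 * #|G|.+2 * y x)%N ->
  forall a, eigenvalue (signless_laplacian R G) a -> a < l.
Proof.
move=> ln y0 yle; apply: (@eigenvalue_lt _ _ (fun x => (y x)%:R)) => x.
  by rewrite ltr0n.
rewrite -natr_sum -natrM -natrD.
have := yle x; set D := (_ * y x + _)%N.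
rewrite -(ler_nat R) natrD !natrM -lerBrDr => le1.
rewrite -(ltr_pM2l (ltr0Sn R #|G|)) mulrA; apply: le_lt_trans le1 _.
by rewrite -mulrBl ltr_pM2r // ltr0n.
Qed.

(** The eigenvector takes one value on each side of the join.  The values are in
    the ratio [1 : 2 / (l - 2)]; the factor [l - 2] clears the denominator. *)
Lemma eigenvalue_S_graph (R : realType) (n : nat) (l : R) : (2 <= n)%N ->
  l != 2 -> l * l = n.+2%:R * l - 4 ->
  eigenvalue (signless_laplacian R (S_graph n 2)) l.
Proof.
move=> n2 l2 lE; apply/eigenvalue_signlessP.
pose f (x : S_graph n 2) : R := if x is inl _ then l - 2 else 2.
exists f; first by exists (inl ord0); rewrite subr_eq0.
move=> x; have -> : (degree x)%:R * f x = \sum_(y | edge x y) f x.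
  rewrite sumr_const mulr_natl; congr (_ *+ _).
  by apply: eq_card => y; rewrite inE.
rewrite -big_split /= big_sumType /=.
case: x => x /=.
  rewrite big_mkcond big_ord_recl big_ord1 sumr_const card_ord.
  rewrite -[in X in _ + X = _](mulr_natr _ (n - 2)) natrB // -addn2 natrD in lE *.
  by case: x => [[|[|//]]] ? /=; rewrite /complete_rel /=; lra.
rewrite big_ord_recl big_ord1 big_pred0.
  by rewrite addr0 /=; lra.
by move=> y; rewrite /compl_rel /= /complete_rel andbN.
Qed.

(** * The local structure of a graph without a 5-cycle *)

Lemma contains_C5 (G : sgraph) (a b c d e : G) :
  edge a b -> edge b c -> edge c d -> edge d e -> edge e a ->
  a != c -> a != d -> b != d -> b != e -> c != e ->
  contains G (cycle_graph 5).
Proof.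
move=> ab bc cd de ea ac ad bd be ce.
have us : uniq [:: a; b; c; d; e].
  rewrite /= !inE !negb_or ac ad bd be ce (eq_sym a e).
  by rewrite (edge_neq ab) (edge_neq bc) (edge_neq cd)
             (edge_neq de) (edge_neq ea).
exists (fun i : 'I_5 => nth a [:: a; b; c; d; e] i).
  by move=> i j /eqP; rewrite nth_uniq // => /eqP/val_inj.
have sy x y : edge x y -> edge y x by rewrite edge_sym.
case=> [[|[|[|[|[|//]]]]]] ?; case=> [[|[|[|[|[|//]]]]]] ? //= _; auto.
Qed.

Section C5Free.
Variables (G : sgraph) (noC5 : ~ contains G (cycle_graph 5)).
Implicit Types u v w t x y z : G.

(** A path [a v w b] inside the neighbourhood of [u] closes into a 5-cycle
    through [u], unless its ends coincide. *)
Lemma no_P4_nbhd u a v w b :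
  edge u a -> edge u v -> edge u w -> edge u b ->
  edge a v -> edge v w -> edge w b -> a != w -> b != v -> a = b.
Proof.
move=> ua uv uw ub av vw wb aw bv; apply/eqP/negPn/negP => ab.
apply: noC5; apply: (@contains_C5 _ u a v w b) => //.
- by rewrite edge_sym.
- exact: edge_neq.
- exact: edge_neq.
- by rewrite eq_sym.
Qed.

(** An edge [v w] of the neighbourhood lies in a star, and then one of its ends
    is a leaf, or in a triangle component.  Indeed, if [v] has a further
    neighbour [a] in it and [w] a further neighbour [b], then [a = b], for all
    choices of [a] and [b]. *)
Lemma codegree_edge u v w : edge u v -> edge u w -> edge v w ->
  [\/ codegree u v = 1, codegree u w = 1
    | codegree u v = 2 /\ codegree u w = 2]%N.
Proof.
move=> uv uw vw; have wv : edge w v by rewrite edge_sym.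
have S (p q : G) : edge u p -> edge u q -> edge p q ->
    codegree u p = 1%N \/ exists2 a, a \in nbhd u :&: nbhd p & a != q.
  move=> up uq pq; case: (set_0Vmem ((nbhd u :&: nbhd p) :\ q)) => [e|[a]].
    left; apply/eqP/cards1P; exists q.
    apply/eqP; rewrite eqEsubset sub1set !inE uq pq andbT.
    by rewrite -setD_eq0 e eqxx.
  by rewrite in_setD1 => /andP[aq ain]; right; exists a.
have [?|[a]] := S v w uv uw vw; first by constructor 1.
rewrite in_conbhd => /andP[ua va] aw.
have [?|[b]] := S w v uw uv wv; first by constructor 2.
rewrite in_conbhd => /andP[ub wb] bv; constructor 3.
have K (c e : G) : edge u c -> edge v c -> c != w -> edge u e -> edge w e ->
    e != v -> c = e.
  by move=> *; apply: (@no_P4_nbhd u c v w e) => //; rewrite edge_sym.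
have eab := K _ _ ua va aw ub wb bv; subst b.
split.
  have -> : codegree u v = #|[set w; a]|; last by rewrite cards2 eq_sym aw.
  apply: eq_card => c; rewrite in_conbhd !inE.
  apply/andP/orP => [[uc vc]|[]/eqP-> //].
  have [->|cw] := eqVneq c w; [by left|right].
  by apply/eqP; apply: K.
have -> : codegree u w = #|[set v; a]|; last by rewrite cards2 eq_sym bv.
apply: eq_card => c; rewrite in_conbhd !inE.
apply/andP/orP => [[uc wc]|[]/eqP-> //].
have [->|cv] := eqVneq c v; [by left|right].
by apply/eqP; apply/esym; apply: K.
Qed.

(** Isolated vertices, and ends of isolated edges, of the graph induced on the
    neighbourhood.  By [codegree_far] a vertex outside can see two vertices of
    the neighbourhood only if both are of one of these kinds, while
    [sum_codegree_nbhd] shows that both kinds reduce the number of edges. *)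
Definition lonely u : {set G} := [set v in nbhd u | codegree u v == 0%N].
Definition paired u : {set G} :=
  [set v in nbhd u | (codegree u v == 1%N) &&
     [exists w in nbhd u :&: nbhd v, codegree u w == 1%N]].

(** Discharging.  Each edge of the neighbourhood carries two units of charge,
    which go to its end of smaller codegree, or one to each end when they are
    equal.  By [codegree_edge] a vertex of a triangle receives 2, and in a star
    with several leaves each leaf receives 2 and the centre 0, whereas an
    isolated vertex receives 0 and the end of an isolated edge 1. *)
Lemma sum_codegree_nbhd u :
  (\sum_(v in nbhd u) codegree u v + 2 * #|lonely u| + #|paired u|
    <= 2 * degree u)%N.
Proof.
pose h := codegree u.
pose phi v w := ((h v <= h w) + (h v < h w))%N.
(* [phi v w + phi w v = 2], so [phi] redistributes the two units of an edge *)
have E : (\sum_(v in nbhd u) h v =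
          \sum_(v in nbhd u) \sum_(w in nbhd u :&: nbhd v) phi v w)%N.
  have sw : (\sum_(v in nbhd u) \sum_(w in nbhd u :&: nbhd v) phi w v =
             \sum_(v in nbhd u) \sum_(w in nbhd u :&: nbhd v) phi v w)%N.
    rewrite (exchange_big_dep (mem (nbhd u))) /=; last first.
      by move=> v w _; rewrite !inE => /andP[].
    apply: eq_bigr => v uv; apply: eq_bigl => w.
    by rewrite !inE (edge_sym w); move: uv; rewrite inE => ->.
  apply/eqP; rewrite -(eqn_pmul2l (isT : 0 < 2)%N) !mul2n -!addnn -{2}sw.
  rewrite -!big_split /=; apply/eqP/eq_bigr => v _.
  rewrite -big_split /= (eq_bigr (fun=> 2%N)).
    by rewrite sum_nat_const -/(codegree u v) -/(h v); lia.
  by move=> w _; rewrite /phi; lia.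
rewrite {}E.
have -> : #|lonely u| = (\sum_(v in nbhd u) (h v == 0%N))%N.
  rewrite -sum1_card big_mkcond [RHS]big_mkcond; apply: eq_bigr => v _.
  by rewrite [v \in lonely u]inE -/(h v); case: (v \in nbhd u); case: (h v == 0%N).
have -> : #|paired u| = (\sum_(v in nbhd u) (v \in paired u))%N.
  rewrite -sum1_card big_mkcond [RHS]big_mkcond; apply: eq_bigr => v _.
  by rewrite [v \in paired u]inE; case: (v \in nbhd u) => //=; case: ifP.
have -> : (2 * degree u = \sum_(v in nbhd u) 2)%N.
  by rewrite sum_nat_const mulnC.
rewrite big_distrr -!big_split /=; apply: leq_sum => v uv.
have uv' : edge u v by rewrite -in_nbhd.
have [h0|h1|h1] := ltngtP (h v) 1%N.
- have hv : h v = 0%N by lia.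
  have /eqP := hv; rewrite cards_eq0 => /eqP ->; rewrite big_set0 eqxx.
  by rewrite inE -/(h v) hv andbF.
- have -> : (v \in paired u) = false by rewrite inE -/(h v); lia.
  (* each neighbour sends 1 in a triangle, where [h v = 2], and 0 otherwise *)
  apply: leq_trans (_ : h v * (h v == 2) <= _)%N; last by lia.
  rewrite (_ : h v == 0%N = false) ?addn0; last by lia.
  rewrite -[X in (_ <= X)%N]sum_nat_const; apply: leq_sum => w.
  rewrite in_conbhd => /andP[uw vw].
  by case: (codegree_edge uv' uw vw); rewrite /phi -/(h v) -/(h w); lia.
have /eqP/cards1P[w wP] := h1.
rewrite wP big_set1 h1 /= addn0 inE -/(h v) h1 /= wP uv.
case: existsP => [[z]|_]; last by rewrite /phi h1; lia.
by rewrite inE => /andP[/eqP-> /eqP]; rewrite /phi h1 -/(h w) => ->.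
Qed.

(** If [w], outside the neighbourhood of [u], sees [v] and [v'] in it and [v] has
    there a neighbour [x] other than [v'], then [u v' w v x] is a 5-cycle.  So a
    vertex seen by [w] has no neighbour in the neighbourhood of [u] but [v'], for
    every other [v'] seen by [w].  If [w] sees three vertices or more, they are
    therefore all isolated; if it sees two, they are isolated or the ends of an
    isolated edge. *)
Lemma codegree_far u w : u != w -> ~~ edge u w ->
  (codegree u w <= maxn 1 #|lonely u|)%N \/
  (codegree u w = 2 /\ 2 <= #|paired u|)%N.
Proof.
move=> nuw euw.
have step v v' x : edge u v -> edge w v -> edge u v' -> edge w v' -> v != v' ->
    edge u x -> edge v x -> x = v'.
  move=> uv wv uv' wv' vv' ux vx; apply/eqP/negPn/negP => xv'.
  apply: noC5; apply: (@contains_C5 _ u v' w v x) => //; try by rewrite edge_sym.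
  - exact: edge_neq.
  - by rewrite eq_sym.
  - by rewrite eq_sym.
  - by apply: contraNneq euw => ->.
have [k1|k1] := leqP (codegree u w) 1; first by left; rewrite leq_max k1.
have [/existsP[v /andP[]]|none] :=
  boolP [exists v in nbhd u :&: nbhd w, codegree u v != 0%N]; last first.
  left; rewrite leq_max; apply/orP; right; apply: subset_leq_card.
  apply/subsetP => v vin; rewrite inE; move/existsPn: none => /(_ v).
  rewrite vin /= negbK => ->; rewrite andbT.
  by move: vin; rewrite inE => /andP[].
rewrite in_conbhd => /andP[uv wv] hv; right.
have [x] : exists x, x \in nbhd u :&: nbhd v by apply/card_gt0P; rewrite lt0n.
rewrite in_conbhd => /andP[ux vx].
have common y : edge u y -> edge w y -> y = v \/ y = x.
  move=> uy wy; have [->|yv] := eqVneq y v; [by left|right].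
  by apply/esym; apply: (step v) => //; rewrite eq_sym.
have [y yin yv] : exists2 y, y \in nbhd u :&: nbhd w & y != v.
  have /card_gt0P[y] : (0 < #|(nbhd u :&: nbhd w) :\ v|)%N.
    have := cardsD1 v (nbhd u :&: nbhd w); rewrite -/(codegree u w).
    by rewrite in_conbhd uv wv; lia.
  by rewrite in_setD1 => /andP[? ?]; exists y.
have /andP[uy wy] : edge u y && edge w y by rewrite -in_conbhd.
have wx : edge w x.
  by case: (common y uy wy) => [/eqP|<- //]; rewrite (negPf yv).
have xv : edge x v by rewrite edge_sym.
have vx' : v != x by apply: edge_neq.
have cv : nbhd u :&: nbhd v = [set x].
  apply/setP => z; rewrite in_conbhd inE; apply/andP/eqP => [[uz vz]|-> //].
  exact: (step v).
have cx : nbhd u :&: nbhd x = [set v].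
  apply/setP => z; rewrite in_conbhd inE; apply/andP/eqP => [[uz xz]|-> //].
  by apply: (step x) => //; rewrite eq_sym.
split.
  have -> : codegree u w = #|[set v; x]|; last by rewrite cards2 vx'.
  apply: eq_card => z; rewrite in_conbhd !inE.
  apply/andP/orP => [[uz wz]|[]/eqP-> //].
  by case: (common z uz wz) => ->; rewrite eqxx; [left|right].
apply: leq_trans (_ : #|[set v; x]| <= _)%N; first by rewrite cards2 vx'.
apply: subset_leq_card; rewrite subUset !sub1set !inE uv ux /codegree cv cx.
rewrite !cards1 /=; apply/andP; split; apply/existsP.
  by exists x; rewrite in_set1 eqxx cx cards1.
by exists v; rewrite in_set1 eqxx cv cards1.
Qed.

(** * Graphs without a dominating vertex: degrees as weights *)

(** Both sides count the walks of length two from [u], on the right by their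
    last vertex: [u] itself, a neighbour of [u], or neither. *)
Lemma sum_degree_nbhd u : (\sum_(v | edge u v) degree v =
  degree u + \sum_(v in nbhd u) codegree u v
  + \sum_(w | (u != w) && ~~ edge u w) codegree u w)%N.
Proof.
have -> : (\sum_(v | edge u v) degree v = \sum_w codegree u w)%N.
  rewrite (eq_bigr (fun v => \sum_(w | edge v w) 1)%N); last first.
    by move=> v _; rewrite sum1_card; apply: eq_card => w; rewrite inE.
  rewrite (exchange_big_dep predT) //=; apply: eq_bigr => w _.
  rewrite sum1_card; apply: eq_card => v.
  by rewrite in_conbhd [edge w v]edge_sym.
rewrite (bigD1 u) //= [X in (X + _)%N](_ : _ = degree u); last first.
  by rewrite /codegree setIid.
rewrite -addnA; congr (_ + _)%N.
rewrite (bigID (edge u)) /=; congr (_ + _)%N; apply: eq_bigl => w.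
  rewrite inE andb_idl // eq_sym; exact: edge_neq.
by rewrite eq_sym.
Qed.

Lemma card_far u :
  (degree u + #|[pred w | (u != w) && ~~ edge u w]|).+1 = #|G|.
Proof.
rewrite -(cardC (pred1 u)) card1 add1n; congr _.+1.
rewrite -(cardID (edge u) (predC (pred1 u))); congr (_ + _)%N.
  apply: eq_card => w; rewrite !inE.
  by rewrite [w \in edge u]unfold_in andb_idl // eq_sym; apply: edge_neq.
by apply: eq_card => w; rewrite !inE [w \in edge u]unfold_in eq_sym andbC.
Qed.

(** Here [d] is the degree of a vertex, [w] the number of vertices that are
    neither it nor its neighbours, [i] and [p] the numbers of isolated vertices
    and of ends of isolated edges in its neighbourhood, and [s] and [t] the two
    sums of codegrees in [sum_degree_nbhd].  With [n = d + w + 1] the claim says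
    that [d (w + 2) - (s + t)] is at least [4 d / (n + 1)], a quantity below 4.
    This difference is at least [w (d - i) + 2 i] if [i >= 2]; otherwise it is
    at least [w (d - 1) + 2 i] in the first case of the last hypothesis and
    [w (d - 2) + 2] in the second. *)
Lemma degree_bound_arith (d w i p s t : nat) :
  (0 < d -> 0 < w -> 5 <= d + w -> s + 2 * i + p <= 2 * d -> i <= d ->
   (d = 1 -> i = 1) ->
  t <= w * maxn 1 i \/ 2 <= p /\ t <= w * maxn 2 i ->
  (d + w + 2) * (d * d + (d + s + t)) + 4 * d <= (d + w + 2) * (d + w + 3) * d)%N.
Proof.
move=> d0 w0 dw si id d1 tP.
suff [r rle dr] : exists2 r, (s + t + r <= d * (w + 2))%N &
                             (4 * d <= (d + w + 2) * r)%N.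
  have e : ((d + w + 3) * d = d * d + (d + d * (w + 2)))%N by nia.
  have := leq_mul (leqnn (d + w + 2)%N) rle; rewrite -(mulnA _ (d + w + 3)%N) e.
  by move: (d + w + 2)%N (d * (w + 2))%N dr => K L dr; rewrite !mulnDr; lia.
have [i2|i1] := leqP 2 i.
  have {}tP : (t <= w * i)%N by case: tP => [|[_]]; nia.
  by exists (w * (d - i) + 2 * i)%N; nia.
have [d1'|d2] := leqP d 1.
  (* one isolated vertex: the difference is [n - t], and [t <= w = n - 2] *)
  have ed : d = 1%N by lia.
  have ei : i = 1%N by apply: d1.
  by subst; exists 2; case: tP => [|[p2]]; nia.
case: tP => [tP|[p2 tP]].
  have {}tP : (t <= w)%N by nia.
  exists (w * (d - 1))%N; first by nia.
  by have [d4|d3] := leqP 4 d; nia.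
have {}tP : (t <= w * 2)%N by nia.
exists (w * (d - 2) + 2)%N; first by nia.
have : (d <= w * (d - 2) + 2)%N by nia.
nia.
Qed.

Lemma sum_degree_bound u : (6 <= #|G|)%N -> (0 < degree u)%N ->
  ((degree u).+1 < #|G|)%N ->
  (#|G|.+1 * (degree u * degree u + \sum_(v | edge u v) degree v) + 4 * degree u
    <= #|G|.+1 * #|G|.+2 * degree u)%N.
Proof.
move=> n6 d0 dn.
have eG := card_far u; set w := #|_| in eG.
rewrite sum_degree_nbhd.
have H := sum_codegree_nbhd u.
have li : (#|lonely u| <= degree u)%N.
  by apply: subset_leq_card; apply/subsetP => v; rewrite !inE => /andP[].
have d1 : degree u = 1%N -> #|lonely u| = 1%N.
  move=> /eqP/cards1P[v]; rewrite -/(nbhd u) => vP.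
  have -> : lonely u = [set v]; last exact: cards1.
  apply/setP => z; rewrite in_set vP in_set1; have [->|//] := eqVneq z v.
  rewrite /codegree vP cards_eq0 -subset0; apply/subsetP => y.
  by rewrite in_setI in_set1 => /andP[/eqP->]; rewrite in_nbhd edge_irr.
have := @degree_bound_arith (degree u) w #|lonely u| #|paired u|
  (\sum_(v in nbhd u) codegree u v)
  (\sum_(w | (u != w) && ~~ edge u w) codegree u w).
have -> : (degree u + w + 2 = #|G|.+1)%N by lia.
have -> : (degree u + w + 3 = #|G|.+2)%N by lia.
apply => //; try lia.
have [p2|p1] := leqP 2 #|paired u|; [right; split=> //|left];
  rewrite /w -sum_nat_const; apply: leq_sum => x /andP[ux eux];
  case: (codegree_far ux eux); lia.
Qed.

(** * Graphs with a dominating vertex *)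

Lemma degree_dominated u v : (forall y, y != u -> edge u y) -> v != u ->
  degree v = (codegree u v).+1.
Proof.
move=> dom vu; rewrite -[_.+1]add1n.
have -> : degree v = #|u |: (nbhd u :&: nbhd v)|.
  apply: eq_card => z; rewrite !inE; have [->|zu] := eqVneq z u.
    by rewrite edge_sym dom.
  by rewrite dom.
by rewrite cardsU1 inE in_nbhd edge_irr.
Qed.

(** A vertex [v] of degree at least two in the neighbourhood of [u] is the centre
    of a star, all of whose leaves have codegree 1, or lies in a triangle
    component, where all codegrees are 2. *)
Lemma sum_codegree_conbhd u v : edge u v ->
  (2 <= codegree u v)%N ->
  (\sum_(w in nbhd u :&: nbhd v) codegree u w = codegree u v)%N \/
  (codegree u v = 2 /\ \sum_(w in nbhd u :&: nbhd v) codegree u w = 4)%N.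
Proof.
move=> uv h2.
have P w : w \in nbhd u :&: nbhd v -> codegree u w = 1%N \/
    codegree u v = 2%N /\ codegree u w = 2%N.
  rewrite in_conbhd => /andP[uw vw].
  by case: (codegree_edge uv uw vw) => [e||]; [rewrite e in h2|left|right].
have [/existsP[x /andP[xin x1]]|none] :=
  boolP [exists x in nbhd u :&: nbhd v, codegree u x != 1%N]; last first.
  left; rewrite (eq_bigr (fun=> 1%N)) ?sum1_card // => w win.
  by move/existsPn: none => /(_ w); rewrite win /= negbK => /eqP.
(* by [codegree_edge] the edge from [v] to [x] lies in a triangle component *)
have [ev ex] : codegree u v = 2%N /\ codegree u x = 2%N.
  by case: (P x xin) => // e; rewrite e in x1.
right; split=> //; rewrite (eq_bigr (fun=> 2%N)).
  by rewrite sum_nat_const -/(codegree u v) ev.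
move=> w win; have [->|wx] := eqVneq w x; first by [].
have /andP[ux vx] : edge u x && edge v x by rewrite -in_conbhd.
have /andP[uw vw] : edge u w && edge v w by rewrite -in_conbhd.
have [y yin yv] : exists2 y, y \in nbhd u :&: nbhd x & y != v.
  have /card_gt0P[y] : (0 < #|(nbhd u :&: nbhd x) :\ v|)%N.
    have := cardsD1 v (nbhd u :&: nbhd x); rewrite -/(codegree u x) ex.
    by rewrite in_conbhd uv [edge x v]edge_sym vx; lia.
  by rewrite in_setD1 => /andP[? ?]; exists y.
have /andP[uy xy] : edge u y && edge x y by rewrite -in_conbhd.
have ewy : w = y.
  by apply: (@no_P4_nbhd u w v x y) => //; rewrite edge_sym.
case: (P w win) => [/eqP/cards1P[z zP]|[] //].
have : v \in nbhd u :&: nbhd w by rewrite in_conbhd uv edge_sym.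
have : x \in nbhd u :&: nbhd w by rewrite in_conbhd ux ewy edge_sym.
by rewrite zP !in_set1 => /eqP xz /eqP vz; rewrite xz vz edge_irr in vx.
Qed.

(** The inequality of [dominated_bound] at a vertex of codegree [h], where [s] is
    the sum of the codegrees of its neighbours other than the centre: an
    isolated vertex of the neighbourhood, a leaf of a star, the centre of a star
    with [h] leaves, and a vertex of a triangle. *)
Lemma dominated_bound_arith (n h s : nat) : (6 <= n -> h + 3 <= n ->
  h = 0 /\ s = 0 \/ h = 1 /\ s + 3 <= n \/ 2 <= h /\ s = h \/ h = 2 /\ s = 4 ->
  n.+1 * (h.+1 * (10 + 7 * h) + (10 * n.-1 + (10 * h + 7 * s)))
    + 4 * (10 + 7 * h) <= n.+1 * n.+2 * (10 + 7 * h))%N.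
Proof.
case: n => // m /= m5 hm [[-> ->]|[[-> sm]|[[h2 ->]|[-> ->]]]]; nia.
Qed.

(** Up to the factor [10 (n - 1)] the weight is 1 at [u] and
    [(1 + b h) / (n - 1)] elsewhere, with [b = 7 / 10].  As the codegrees sum to
    at most [2 (n - 1)], the row of [u] asks for [1 + 2 b < 3 - 4 / q0], that
    is, [b < 0.73] when [n = 6].  The centre of a star on all but one of the
    other vertices, [h = n - 3], asks for [b >= 2 / 3] as [n] grows. *)
Lemma dominated_bound u : (6 <= #|G|)%N -> (forall y, y != u -> edge u y) ->
  (forall w, w != u -> (codegree u w).+2 != #|G|) ->
  let y x := (if x == u then 10 * #|G|.-1 else 10 + 7 * codegree u x)%N in
  forall x, (#|G|.+1 * (degree x * y x + \sum_(z | edge x z) y z) + 4 * y x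
     <= #|G|.+1 * #|G|.+2 * y x)%N.
Proof.
move=> n6 dom nstar y x; rewrite {1 3 4}/y.
have yE z : z != u -> y z = (10 + 7 * codegree u z)%N.
  by rewrite /y => /negPf->.
have [->|xu] := eqVneq x u.
  have du : degree u = #|G|.-1.
    have := cardC (pred1 u); rewrite card1 => <-; apply: eq_card => z.
    by rewrite !inE; apply/idP/idP => [/edge_neq|/dom //]; rewrite eq_sym.
  have -> : (\sum_(z | edge u z) y z
             = 10 * degree u + 7 * \sum_(z in nbhd u) codegree u z)%N.
    rewrite (eq_bigr (fun z => 10 + 7 * codegree u z)%N); last first.
      by move=> z uz; rewrite yE // eq_sym edge_neq.
    rewrite big_split -big_distrr sum_nat_const mulnC /=.
    congr (10 * _ + 7 * _)%N; first by apply: eq_card => z; rewrite inE.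
    by apply: eq_bigl => z; rewrite inE.
  have := sum_codegree_nbhd u.
  by rewrite du; case: #|G| n6 => // m /=; nia.
have lt w : w != u -> (codegree u w + 3 <= #|G|)%N.
  move=> wu; have := nstar w wu.
  suff : (codegree u w + 2 <= #|G|)%N by lia.
  rewrite -(cardsC (nbhd u :&: nbhd w)) leq_add2l.
  apply: leq_trans (_ : #|[set u; w]| <= _)%N; first by rewrite cards2 eq_sym wu.
  by apply: subset_leq_card; rewrite subUset !sub1set !inE !edge_irr andbF.
have ux : edge u x by apply: dom.
rewrite (degree_dominated dom xu) (bigD1 u) 1?edge_sym //= {1}/y eqxx.
rewrite (eq_bigl (fun z => z \in nbhd u :&: nbhd x)); last first.
  move=> z; rewrite in_conbhd andbC; have [->|zu] := eqVneq z u.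
    by rewrite edge_irr.
  by rewrite dom.
rewrite (eq_bigr (fun z => 10 + 7 * codegree u z)%N); last first.
  by move=> z; rewrite in_conbhd => /andP[uz _]; rewrite yE // eq_sym edge_neq.
rewrite big_split -big_distrr sum_nat_const /= -/(codegree u x).
rewrite (mulnC (codegree u x) 10).
apply: dominated_bound_arith => //; first exact: lt.
have [h0|h1|h1] := ltngtP (codegree u x) 1%N.
- have h0' : codegree u x = 0%N by lia.
  left; split=> //; apply: big1 => w.
  by move: h0' => /eqP; rewrite cards_eq0 => /eqP ->; rewrite inE.
- by right; right; case: (sum_codegree_conbhd ux h1) => [->|]; [left|right].
have /eqP/cards1P[w wP] := h1; right; left; split=> //.
rewrite wP big_set1; apply: lt.
have : w \in nbhd u :&: nbhd x by rewrite wP in_set1.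
by rewrite in_conbhd eq_sym => /andP[/edge_neq].
Qed.

(** All vertices other than [u] and [w] are common neighbours of [u] and [w], so
    [w] is dominating too.  An edge [y z] between two of them closes the 5-cycle
    [u y z w t], where [t] is any fifth vertex. *)
Lemma isomorphic_S_graph2 u w : (6 <= #|G|)%N -> (forall y, y != u -> edge u y) ->
  w != u -> (codegree u w).+2 = #|G| -> isomorphic G (S_graph #|G| 2).
Proof.
move=> n6 dom wu cw.
have cA : #|~: [set u; w]| = (#|G| - 2)%N.
  by have := cardsC [set u; w]; rewrite cards2 eq_sym wu; lia.
have domw y : y != w -> edge w y.
  move=> yw; have [->|yu] := eqVneq y u; first by rewrite edge_sym dom.
  have eA : nbhd u :&: nbhd w = ~: [set u; w].
    apply/eqP; rewrite eqEcard cA -cw; apply/andP; split; last first.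
      by rewrite /codegree; lia.
    apply/subsetP => z; rewrite in_conbhd !inE negb_or => /andP[uz wz].
    by rewrite !(eq_sym z) !edge_neq.
  have : y \in nbhd u :&: nbhd w by rewrite eA !inE negb_or yu yw.
  by rewrite in_conbhd => /andP[].
have indep y z : y != u -> y != w -> z != u -> z != w -> edge y z = false.
  move=> yu yw zu zw; apply/negP => yz; apply: noC5.
  have /card_gt0P[t] : (0 < #|~: [set u; w; y; z]|)%N.
    have := cardsC [set u; w; y; z].
    have : (#|[set u; w; y; z]| <= 4)%N.
      by rewrite !cardsU !cards1; lia.
    lia.
  rewrite !inE !negb_or -!andbA => /and4P[tu tw ty tz].
  apply: (@contains_C5 _ u y z w t) => //; rewrite 1?eq_sym //.
  - exact: dom.
  - by rewrite edge_sym domw.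
  - exact: domw.
  - by rewrite edge_sym dom.
have [x0 x0A] : exists x0, x0 \in ~: [set u; w].
  by apply/card_gt0P; rewrite cA subn_gt0 (leq_trans _ n6).
pose g x : 'I_(#|G| - 2) := cast_ord cA (enum_rank_in x0A x).
pose f x : S_graph #|G| 2 := if x == u then inl ord0 else
  if x == w then inl ord_max else inr (g x).
have fP x : [\/ x = u /\ f x = inl ord0, x = w /\ f x = inl ord_max
             | [/\ x != u, x != w & f x = inr (g x)]].
  rewrite /f; have [->|xu] := eqVneq x u; first by constructor 1.
  by have [->|xw] := eqVneq x w; [constructor 2|constructor 3].
have injf : injective f.
  move=> x y; case: (fP x) => [[-> ->]|[-> ->]|[xu xw ->]];
    case: (fP y) => [[-> ->]|[-> ->]|[yu yw ->]] //.
  move=> [/val_inj]; apply: enum_rank_in_inj.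
    by rewrite !inE negb_or xu.
  by rewrite !inE negb_or yu.
exists f.
  by apply: inj_card_bij injf _; rewrite card_sum !card_ord; lia.
move=> x y; case: (fP x) => [[-> ->]|[-> ->]|[xu xw ->]];
    case: (fP y) => [[-> ->]|[-> ->]|[yu yw ->]] /=;
    rewrite ?edge_irr //.
all: try by [rewrite dom | rewrite domw | rewrite edge_sym dom
            | rewrite edge_sym domw].
by rewrite indep // /compl_rel /= /complete_rel andbN.
Qed.
End C5Free.

(** * The extremal graph *)

Unset Implicit Arguments.

Theorem theorem3 (R : realType) (n : nat) (G : sgraph)
  (n_ge6 : (6 <= n)%N) (orderG : #|G| = n)
  (noC5 : ~ contains G (cycle_graph 5)) :
  ~ isomorphic G (S_graph n 2) -> Qindex R G < Qindex R (S_graph n 2).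
Proof.
subst n => notS.
pose N : R := #|G|%:R.
have N6 : 6 <= N by rewrite ler_nat.
pose l : R := (N + 2 + Num.sqrt ((N + 2) ^+ 2 - 16)) / 2.
have lE : l * l = #|G|.+2%:R * l - 4.
  have rE : Num.sqrt ((N + 2) ^+ 2 - 16) = 2 * l - N - 2 by rewrite /l; lra.
  have /sqr_sqrtr : 0 <= (N + 2) ^+ 2 - 16 by nra.
  by rewrite -(addn2 #|G|) natrD -/N rE; lra.
have l0 : N + 2 <= 2 * l.
  by rewrite /l mulrC divfK ?pnatr_eq0 // lerDl sqrtr_ge0.
have ln : #|G|.+1%:R * #|G|.+2%:R - 4 < #|G|.+1%:R * l.
  move: lE; rewrite -(addn2 #|G|) -(addn1 #|G|) !natrD -/N => lE.
  (* at 1 and at [N + 1] the quadratic polynomial equals [3 - N < 0], and so it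
     is negative between them *)
  have lN1 : N + 1 < l.
    rewrite ltNge; apply/negP => lle.
    have : 0 <= (l - 1) * (N + 1 - l) by apply: mulr_ge0; lra.
    by lra.
  have lN2 : l < N + 2 by rewrite -(ltr_pM2l (_ : 0 < l)); lra.
  have : 0 < (N + 2 - l) * (l - N - 1) by apply: mulr_gt0; lra.
  by lra.
have S0 : (0 < #|S_graph #|G| 2|)%N by rewrite card_sum !card_ord.
have G0 : (0 < #|G|)%N by lia.
have lS : l <= Qindex R (S_graph #|G| 2).
  apply: (proj2 (Qindex_max R S0)); apply: eigenvalue_S_graph => //; first lia.
  by rewrite gt_eqF //; lra.
apply: lt_le_trans lS; have [+ _] := Qindex_max R G0.
have [/existsP[u /forallP dom]|nodom] :=
  boolP [exists u : G, forall y, (y != u) ==> edge u y].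
  have {}dom y : y != u -> edge u y by move: (dom y) => /implyP.
  apply: eigenvalue_lt_nat (dominated_bound noC5 n_ge6 dom _) _ => //.
    move=> x /=; case: ifP => // _.
    by rewrite muln_gt0 -subn1 subn_gt0 (leq_trans _ n_ge6).
  by move=> w wu; apply/eqP => cw; apply: notS; apply: isomorphic_S_graph2 cw.
(* [maxn] only serves to make the weight of an isolated vertex positive *)
apply: (@eigenvalue_lt_nat _ _ (fun x => maxn 1 (degree x))) => // x.
  by rewrite leq_max.
have [d0|d0] := posnP (degree x).
  rewrite big_pred0 ?d0 ?maxn0 ?muln1 ?muln0 //.
    by apply: leq_trans (leq_pmulr _ _) => //; lia.
  move=> z; apply/negbTE/negP => xz; move/eqP: d0; apply/negP.
  by rewrite -lt0n; apply/card_gt0P; exists z; rewrite inE.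
rewrite (eq_bigr (fun z => degree z)); last first.
  move=> z xz; apply/maxn_idPr; apply/card_gt0P; exists x.
  by rewrite inE edge_sym.
rewrite (maxn_idPr d0); apply: sum_degree_bound => //.
have := card_far x; rewrite -[X in (X < _)%N]addn0 => <-.
rewrite ltnS ltn_add2l; apply/card_gt0P.
move/existsPn: nodom => /(_ x) /forallPn[y]; rewrite negb_imply => /andP[yx xy].
by exists y; rewrite inE eq_sym yx.
Qed.
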